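(* The logic $\mathcal L(\mathbf L_1^{dm})$ is equivalent to the 3-valued Łukasiewicz logic; that is, the variety $\mathbb V(\mathbf L_1^{dm})$ is term-equivalent to the variety of 3-valued Łukasiewicz algebras.
   Context: $\mathbf L_1^{dm}=\langle\{0,a,1\},\vee,\wedge,\to,{}',0,1\rangle$ is the three-element De Morgan Heyting chain: the lattice is the chain $0<a<1$; $\to$ is the Heyting implication ($x\to y=1$ if $x\le y$, and $x\to y=y$ otherwise); $0'=1$, $a'=a$, $1'=0$. $\mathbb V(\mathbf L_1^{dm})$ is the variety it generates. It is a subvariety of the variety $\mathbb{DHMSH}$ of dually hemimorphic semi-Heyting algebras, and $\mathcal L(\mathbf L_1^{dm})$ is the logic in the language $\langle\vee,\wedge,\to,\sim,\bot,\top\rangle$ corresponding to $\mathbb V(\mathbf L_1^{dm})$, i.e. $\Gamma\vdash\phi$ iff in every $\mathbf A\in\mathbb V(\mathbf L_1^{dm})$ every interpretation (with $\sim,\bot,\top$ interpreted as ${}',0,1$) sending all of $\Gamma$ to $1$ sends $\phi$ to $1$; $\mathbb V(\mathbf L_1^{dm})$ is its equivalent algebraic semantics. A 3-valued Łukasiewicz algebra is an algebra $\langle A,\vee,\wedge,{}',d_1,d_2,0,1\rangle$ such that (1) $\langle A,\vee,\wedge,{}',0,1\rangle$ is a De Morgan algebra; (2) $d_i(x\vee y)=d_i(x)\vee d_i(y)$ for $i=1,2$; (3) $d_i(x)\vee(d_i(x))'=1$ for $i=1,2$; (4) $d_i(d_j(x))=d_j(x)$ for $i,j=1,2$; (5)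 $d_i(x')=(d_{3-i}(x))'$ for $i=1,2$; (6) $d_1(x)\le d_2(x)$; (7) if $d_1(x)=d_1(y)$ and $d_2(x)=d_2(y)$ then $x=y$. It is well known that the class of 3-valued Łukasiewicz algebras is the variety generated by the algebra on the three-element Kleene algebra $0<a<1$ (so $a'=a$) with $d_1(0)=d_1(a)=0$, $d_1(1)=1$, $d_2(0)=0$, $d_2(a)=d_2(1)=1$. The 3-valued Łukasiewicz logic is the logic corresponding to this variety, and two logics are called equivalent here when their corresponding varieties are term-equivalent. *)

(* Defs.v *)
From mathcomp Require Import all_boot.
Set Implicit Arguments.
Unset Strict Implicit.
Unset Printing Implicit Defensive.

(** * Universal algebra *)

Record signature := Signature { symbol :> Type; arity : symbol -> nat }.

Record algebra (S : signature) := Algebra {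
  carrier :> Type;
  op : forall f : S, ('I_(arity f) -> carrier) -> carrier }.

Inductive term (S : signature) (X : Type) : Type :=
| Var of X
| App (f : S) of ('I_(arity f) -> term S X).
Arguments Var {S X}.
Arguments App {S X}.

Fixpoint eval (S : signature) (A : algebra S) (X : Type) (v : X -> A)
    (t : term S X) : A :=
  match t with
  | Var x => v x
  | App f ts => op (fun i => eval v (ts i))
  end.

Definition homomorphism (S : signature) (A B : algebra S) (h : A -> B) : Prop :=
  forall (f : S) (x : 'I_(arity f) -> A), h (op x) = op (fun i => h (x i)).

Definition product (S : signature) (I : Type) (A : I -> algebra S) : algebra S :=
  @Algebra S (forall i, A i) (fun f x i => op (fun k => x k i)).

(* Closure under H, S and P. Subalgebras are taken up to isomorphism, as
   injective homomorphisms into a member of the class; this is harmless since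
   closure under H already gives closure under isomorphism. *)
Definition is_variety (S : signature) (K : algebra S -> Prop) : Prop :=
  [/\ forall (A B : algebra S) (h : A -> B), K A -> homomorphism h ->
        (forall b, exists a, h a = b) -> K B,
      forall (A B : algebra S) (h : B -> A), K A -> homomorphism h ->
        injective h -> K B
    & forall (I : Type) (A : I -> algebra S), (forall i, K (A i)) ->
        K (product A)].

Definition variety_generated (S : signature) (A B : algebra S) : Prop :=
  forall K : algebra S -> Prop, is_variety K -> K A -> K B.

(** * Term equivalence *)

(* An n-ary symbol is translated by a term in the n variables 'I_n. *)
Definition translation (S T : signature) : Type :=
  forall f : S, term T 'I_(arity f).

Definition derived (S T : signature) (s : translation S T) (B : algebra T) :
    algebra S :=
  @Algebra S B (fun f x => eval x (s f)).

Definition same_operations (S : signature) (X : Type)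
    (o1 o2 : forall f : S, ('I_(arity f) -> X) -> X) : Prop :=
  forall (f : S) (x : 'I_(arity f) -> X), o1 f x = o2 f x.

Definition term_equivalent (S T : signature)
    (K : algebra S -> Prop) (L : algebra T -> Prop) : Prop :=
  exists (s : translation S T) (t : translation T S),
    [/\ forall A, K A -> L (derived t A),
        forall B, L B -> K (derived s B),
        forall A, K A ->
          same_operations (@op S (derived s (derived t A))) (@op S A)
      & forall B, L B ->
          same_operations (@op T (derived t (derived s B))) (@op T B)].

(** * Logics *)

Definition formula (S : signature) : Type := term S nat.

Definition logic (S : signature) : Type :=
  (formula S -> Prop) -> formula S -> Prop.

Definition logic_of (S : signature) (top : formula S) (K : algebra S -> Prop) :
    logic S :=
  fun Gamma phi => forall A : algebra S, K A -> forall v : nat -> A,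
    (forall gamma, Gamma gamma -> eval v gamma = eval v top) ->
    eval v phi = eval v top.

(* The element x satisfies the equations delta_i(x) = epsilon_i(x). *)
Definition defining_equations (S : signature) (n : nat)
    (delta epsilon : 'I_n -> term S 'I_1) (A : algebra S) (x : A) : Prop :=
  forall i, eval (fun=> x) (delta i) = eval (fun=> x) (epsilon i).

(* Blok and Pigozzi's notion for varieties, with defining equations
   delta_i(x) = epsilon_i(x) and equivalence formulas Delta_j(x, y). The value of
   delta_i(phi) under v is written as the value of delta_i at eval v phi. *)
Definition equivalent_algebraic_semantics (S : signature)
    (L : logic S) (K : algebra S -> Prop) : Prop :=
  is_variety K /\
  exists (n : nat) (delta epsilon : 'I_n -> term S 'I_1)
         (m : nat) (Delta : 'I_m -> term S 'I_2),
    (forall Gamma phi, L Gamma phi <->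
       forall A : algebra S, K A -> forall v : nat -> A,
         (forall gamma, Gamma gamma ->
            defining_equations delta epsilon (eval v gamma)) ->
         defining_equations delta epsilon (eval v phi)) /\
    (forall A : algebra S, K A -> forall x y : A, x = y <->
       forall j, defining_equations delta epsilon
                   (eval (tnth [tuple x; y]) (Delta j))).

Definition equivalent_logics (S T : signature) (L : logic S) (M : logic T) :
    Prop :=
  exists (K : algebra S -> Prop) (K' : algebra T -> Prop),
    [/\ equivalent_algebraic_semantics L K,
        equivalent_algebraic_semantics M K'
      & term_equivalent K K'].

(** * The De Morgan Heyting chain *)

Inductive chain3 := c0 | ca | c1.

Definition rank (x : chain3) : nat :=
  match x with c0 => 0 | ca => 1 | c1 => 2 end.

Definition le3 (x y : chain3) : bool := rank x <= rank y.
Definition join3 (x y : chain3) : chain3 := if le3 x y then y else x.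
Definition meet3 (x y : chain3) : chain3 := if le3 x y then x else y.
Definition imp3 (x y : chain3) : chain3 := if le3 x y then c1 else y.
Definition neg3 (x : chain3) : chain3 :=
  match x with c0 => c1 | ca => ca | c1 => c0 end.

(* The same signature serves as the language of the logic: dh_neg, dh_bot and
   dh_top are the algebraic ', 0, 1 and the connectives ~, \bot, \top. *)
Inductive dh_symbol := dh_or | dh_and | dh_imp | dh_neg | dh_bot | dh_top.

Definition dh_arity (f : dh_symbol) : nat :=
  match f with
  | dh_or | dh_and | dh_imp => 2
  | dh_neg => 1
  | dh_bot | dh_top => 0
  end.

Definition dh_sig : signature := Signature dh_arity.

Definition L1dm_op (f : dh_symbol) : ('I_(dh_arity f) -> chain3) -> chain3 :=
  match f with
  | dh_or => fun x => join3 (x ord0) (x ord_max)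
  | dh_and => fun x => meet3 (x ord0) (x ord_max)
  | dh_imp => fun x => imp3 (x ord0) (x ord_max)
  | dh_neg => fun x => neg3 (x ord0)
  | dh_bot => fun=> c0
  | dh_top => fun=> c1
  end.

Definition L1dm : algebra dh_sig := @Algebra dh_sig chain3 L1dm_op.

Definition logic_L1dm : logic dh_sig :=
  logic_of (@App dh_sig nat dh_top (tnth [tuple])) (variety_generated L1dm).

(** * Three-valued Lukasiewicz algebras *)

Inductive index := i1 | i2.
Definition flip (i : index) : index := match i with i1 => i2 | i2 => i1 end.

Inductive luk_symbol :=
  luk_or | luk_and | luk_neg | luk_d of index | luk_bot | luk_top.

Definition luk_arity (f : luk_symbol) : nat :=
  match f with
  | luk_or | luk_and => 2
  | luk_neg | luk_d _ => 1
  | luk_bot | luk_top => 0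
  end.

Definition luk_sig : signature := Signature luk_arity.

Definition is_bounded_distributive_lattice (A : Type) (join meet : A -> A -> A)
    (bot top : A) : Prop :=
  [/\ associative join /\ associative meet,
      commutative join /\ commutative meet,
      (forall x y, join x (meet x y) = x) /\ (forall x y, meet x (join x y) = x),
      left_distributive meet join
    & left_id bot join /\ left_id top meet].

Definition is_de_morgan_algebra (A : Type) (join meet : A -> A -> A)
    (neg : A -> A) (bot top : A) : Prop :=
  [/\ is_bounded_distributive_lattice join meet bot top,
      neg bot = top,
      {morph neg : x y / join x y >-> meet x y}
    & involutive neg].

Definition is_lukasiewicz3_algebra (A : algebra luk_sig) : Prop :=
  let join (x y : A) := @op luk_sig A luk_or (tnth [tuple x; y]) in
  let meet (x y : A) := @op luk_sig A luk_and (tnth [tuple x; y]) in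
  let neg (x : A) := @op luk_sig A luk_neg (tnth [tuple x]) in
  let d (i : index) (x : A) := @op luk_sig A (luk_d i) (tnth [tuple x]) in
  let bot : A := @op luk_sig A luk_bot (tnth [tuple]) in
  let top : A := @op luk_sig A luk_top (tnth [tuple]) in
  let le (x y : A) := meet x y = x in
  is_de_morgan_algebra join meet neg bot top /\
  [/\ forall i, {morph d i : x y / join x y},
      forall i x, join (d i x) (neg (d i x)) = top,
      forall i j x, d i (d j x) = d j x,
      forall i x, d i (neg x) = neg (d (flip i) x)
    & (forall x, le (d i1 x) (d i2 x)) /\
      (forall x y, d i1 x = d i1 y -> d i2 x = d i2 y -> x = y)].

Definition lukasiewicz3_logic : logic luk_sig :=
  logic_of (@App luk_sig nat luk_top (tnth [tuple])) is_lukasiewicz3_algebra.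

(* Main.v *)
Require Import Defs.
From mathcomp Require Import all_boot.
From mathcomp Require Import boolp classical_sets.

(** Identities are preserved by homomorphic images, subalgebras and products, so
    one that holds in an algebra holds in the variety which it generates; the two
    varieties are therefore compared through the identities of a three-element
    chain.

    On the chain [0 < a < 1] the two sets of operations are interdefinable:
    [d_1 x = x' -> 0] and [d_2 x = (x -> 0)'], while conversely
    [x -> y = y \/ (((d_1 x)' \/ d_1 y) /\ ((d_2 x)' \/ d_2 y))], the second
    joinand being 1 if [x <= y] and 0 otherwise. That these translations are
    mutually inverse is a set of identities, hence is inherited by every algebra
    satisfying the identities of the chain.

    It remains to see that the Lukasiewicz algebras are exactly the algebras
    satisfying the identities of the chain, here called [luk3]. One direction
    ([models_luk3_lukasiewicz]) is immediate for the equational axioms. The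
    quasi-identity, that [d_1 x] and [d_2 x] determine [x], follows from the
    identity [x /\ (x -> y) = y /\ (y -> x)]: if [d_i x = d_i y] for both [i],
    then [x -> y = y -> x = 1].

    The other direction ([lukasiewicz3_separated]) is a representation theorem.
    Each prime filter [F] of a Lukasiewicz algebra yields a homomorphism to the
    chain, sending [x] to 1 if [d_1 x] is in [F], to [a] if only [d_2 x] is, and
    to 0 otherwise; it respects negation because every [d_i x] is complemented.
    If [x <> y], then [d_i x <> d_i y] for some [i], and some prime filter
    contains exactly one of these two elements; so the algebra embeds in a power
    of the chain. The prime filters come from Zorn's lemma
    ([prime_filter_separation]).

    Finally, each logic has its variety as equivalent algebraic semantics, with
    defining equation [x = 1] and equivalence formulas [x -> y] and [y -> x];
    the identity above shows again that these express equality. *)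

Set Implicit Arguments.
Unset Strict Implicit.
Unset Printing Implicit Defensive.

(** * Prime filters of distributive lattices *)

Section PrimeFilter.
Variables (A : Type) (join meet : A -> A -> A) (bot top : A).
Hypothesis latA : is_bounded_distributive_lattice join meet bot top.

Let le (x y : A) := meet x y = x.

Let meetA : associative meet. Proof. by case: latA => [[]]. Qed.
Let meetC : commutative meet. Proof. by case: latA => _ []. Qed.
Let joinC : commutative join. Proof. by case: latA => _ []. Qed.
Let joinK x y : join x (meet x y) = x. Proof. by case: latA => _ _ []. Qed.
Let meetK x y : meet x (join x y) = x. Proof. by case: latA => _ _ []. Qed.
Let meetDl : left_distributive meet join. Proof. by case: latA. Qed.
Let join0x : left_id bot join. Proof. by case: latA => _ _ _ _ []. Qed.
Let meet1x : left_id top meet. Proof. by case: latA => _ _ _ _ []. Qed.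

Let le_refl x : le x x. Proof. by rewrite /le -{2}(joinK x x) meetK. Qed.

Let le_trans y x z : le x y -> le y z -> le x z.
Proof. by rewrite /le => xy yz; rewrite -xy -meetA yz. Qed.

Let leIl x y : le (meet x y) x.
Proof. by rewrite /le meetC meetA le_refl. Qed.

Let leIr x y : le (meet x y) y. Proof. by rewrite meetC; apply: leIl. Qed.

Let lexI x y z : le x y -> le x z -> le x (meet y z).
Proof. by rewrite /le => xy xz; rewrite meetA xy. Qed.

Let leUx x y z : le x z -> le y z -> le (join x y) z.
Proof. by rewrite /le meetDl => -> ->. Qed.

Let lexUl x y : le x (join x y). Proof. exact: meetK. Qed.

Let lexUr x y : le y (join x y). Proof. by rewrite joinC; apply: lexUl. Qed.

(** The prime filter theorem, for [p] not below [q]. The filter is presented by its characteristic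
    function, as a homomorphism onto the two-element lattice. *)
Lemma prime_filter_separation (p q : A) : meet p q <> p ->
  exists F : A -> bool,
    [/\ F p, ~~ F q,
        forall x y, F (join x y) = F x || F y,
        forall x y, F (meet x y) = F x && F y
      & F bot = false /\ F top = true].
Proof.
move=> pq.
(* Filters avoiding q that are empty or contain p: admitting the empty set
   makes the union of an empty chain admissible. *)
pose P (M : set A) := [/\ forall u w, M u -> M w -> M (meet u w),
  forall u w, M u -> le u w -> M w, ~ M q & forall u, M u -> M p].
have [F FP totF|M [[MI Mup Mq Mp] maxM]] := @Zorn_bigcup A P.
  split=> [u w [X FX Xu] [Y FY Yw]|u w [X FX Xu] uw|[X FX Xq]|u [X FX Xu]].
  - have [XY|YX] := totF _ _ FX FY.
      by exists Y => //; case: (FP _ FY) => YI _ _ _; apply: YI => //; apply: XY.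
    by exists X => //; case: (FP _ FX) => XI _ _ _; apply: XI => //; apply: YX.
  - by exists X => //; case: (FP _ FX) => _ Xup _ _; apply: Xup uw.
  - by case: (FP _ FX).
  - by exists X => //; case: (FP _ FX) => _ _ _; apply; apply: Xu.
(* With the point p added, an empty M is handled like any other filter. *)
pose M' m := M m \/ m = p.
have M'I m n : M' m -> M' n -> M' (meet m n).
  case=> [Mm|->] [Mn|->]; first by left; apply: MI.
  - by left; apply: MI => //; apply: Mp Mm.
  - by left; apply: MI => //; apply: Mp Mn.
  - by right; apply: le_refl.
(* By maximality, an element outside M generates, together with M and p, a
   filter containing q. *)
have ext u : M u \/ exists2 m, M' m & le (meet m u) q.
  apply: contrapT => /not_orP[nMu nq].
  case: (maxM (fun z => exists2 m, M' m & le (meet m u) z)).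
    split=> [z Mz|sub]; first by exists z; [left|apply: leIl].
    by apply/nMu/sub; exists p; [right|apply: leIr].
  split=> [x y [m Mm mx] [n Mn ny]|x y [m Mm mx] xy|//|x _].
  - exists (meet m n); first exact: M'I.
    apply: lexI; [apply: le_trans mx|apply: le_trans ny]; apply: lexI (leIr _ _).
      by apply: le_trans (leIl _ _) (leIl _ _).
    by apply: le_trans (leIl _ _) (leIr _ _).
  - by exists m => //; apply: le_trans xy.
  - by exists p; [right|apply: leIl].
have {}Mp : M p.
  have [//|[m [Mm|->]]] := ext p; last by rewrite le_refl => /pq.
  by move=> mq; case: Mq; apply: Mup mq; apply: MI => //; apply: Mp Mm.
have {M'I} {}ext u : ~ M u -> exists2 m, M m & le (meet m u) q.
  by have [//|[m [Mm|->]]] := ext u; [exists m|exists p].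
exists (fun x => `[<M x>]); split=> [||x y|x y|].
- exact/asboolP.
- exact/asboolPn.
- apply/asboolP/orP => [MU|[|] /asboolP]; last 2 first.
  + by move=> /Mup; apply; apply: lexUl.
  + by move=> /Mup; apply; apply: lexUr.
  apply: contrapT => /not_orP[nx ny].
  have [m Mm mx] := ext x (fun Mx => nx (asboolT Mx)).
  have {nx}[n Mn {}ny] := ext y (fun My => ny (asboolT My)).
  apply: Mq; apply: (Mup (meet (join x y) (meet m n))).
    by apply: (MI) => //; apply: MI.
  rewrite meetDl; apply: leUx; [apply: le_trans mx|apply: le_trans ny].
    by apply: lexI (leIl _ _); apply: le_trans (leIr _ _) (leIl _ _).
  by apply: lexI (leIl _ _); apply: le_trans (leIr _ _) (leIr _ _).
- apply/asboolP/andP => [Mxy|[/asboolP Mx /asboolP My]]; last exact: MI.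
  by split; apply/asboolP; apply: Mup Mxy _; [apply: leIl|apply: leIr].
split; last by apply/asboolP; apply: Mup Mp _; rewrite /le meetC meet1x.
apply/asboolP => Mbot; apply: Mq; apply: Mup Mbot _.
by rewrite /le -{1}(join0x q) meetK.
Qed.

End PrimeFilter.

(** * Identities and varieties *)

(** The identity [p = q] holds in [A]. *)
Definition satisfies (S : signature) (X : Type) (A : algebra S)
    (p q : term S X) : Prop :=
  forall v : X -> A, eval v p = eval v q.

(** [models A B]: the algebra [B] satisfies every identity of [A]. *)
Definition models (S : signature) (A B : algebra S) : Prop :=
  forall (X : Type) (p q : term S X), satisfies A p q -> satisfies B p q.

(** Distinct elements of [B] are distinguished by a homomorphism into [A]; that
    is, [B] is isomorphic to a subalgebra of a power of [A]. *)
Definition separated (S : signature) (A B : algebra S) : Prop :=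
  forall x y : B, (forall h : B -> A, homomorphism h -> h x = h y) -> x = y.

Lemma eval_hom (S : signature) (A B : algebra S) (h : A -> B) (X : Type)
    (v : X -> A) (t : term S X) :
  homomorphism h -> h (eval v t) = eval (h \o v) t.
Proof.
move=> homh; elim: t => //= f ts IH.
by rewrite homh; congr op; apply: funext.
Qed.

Lemma eval_product (S : signature) (I : Type) (A : I -> algebra S) (X : Type)
    (v : X -> product A) (t : term S X) (i : I) :
  eval v t i = eval (fun x => v x i) t.
Proof. by rewrite (@eval_hom _ (product A) (A i) (fun a => a i)). Qed.

Lemma models_variety (S : signature) (A : algebra S) : is_variety (models A).
Proof.
split=> [B C h mB homh surj|B C h mB homh inj|I B mB] X p q Apq v.
- have [w wP] := choice (fun x => surj (v x)).
  have -> : v = h \o w by apply: funext => x; rewrite /= wP.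
  by rewrite -!eval_hom // (mB _ _ _ Apq).
- by apply: inj; rewrite !eval_hom //; apply: mB Apq _.
- apply: functional_extensionality_dep => i.
  by rewrite !eval_product; apply: mB Apq _.
Qed.

Lemma variety_generated_variety (S : signature) (A : algebra S) :
  is_variety (variety_generated A).
Proof.
split=> [B C h gB homh surj|B C h gB homh inj|I B gB] K varK KA.
- by case: (varK) => KH _ _; apply: (KH B C h) => //; apply: gB.
- by case: (varK) => _ KS _; apply: (KS B C h) => //; apply: gB.
- by case: (varK) => _ _ KP; apply: KP => i; apply: gB.
Qed.

Lemma variety_generated_models (S : signature) (A B : algebra S) :
  variety_generated A B -> models A B.
Proof. by apply; first apply: models_variety. Qed.

Lemma separated_variety_generated (S : signature) (A B : algebra S) :
  separated A B -> variety_generated A B.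
Proof.
move=> sepB K [_ KS KP] KA.
pose I := {h : B -> A | homomorphism h}.
apply: (KS (product (fun _ : I => A)) B (fun x i => sval i x)).
- exact: KP.
- by move=> f x; apply: functional_extensionality_dep => -[h homh]; apply: homh.
- move=> x y exy; apply: sepB => h homh.
  exact: (congr1 (fun g : product (fun _ : I => A) => g (exist _ h homh)) exy).
Qed.

(** * Translations *)

(** Simultaneous substitution of the terms [u x] for the variables [x]. *)
Fixpoint subst (S : signature) (X Y : Type) (u : X -> term S Y)
    (t : term S X) : term S Y :=
  match t with
  | Var x => u x
  | App f ts => App f (fun i => subst u (ts i))
  end.

(** The extension of a translation of symbols to all terms. *)
Fixpoint translate (S T : signature) (s : translation S T) (X : Type)
    (t : term S X) : term T X :=
  match t with
  | Var x => Var x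
  | App f ts => subst (fun i => translate s (ts i)) (s f)
  end.

Lemma eval_subst (S : signature) (A : algebra S) (X Y : Type)
    (u : X -> term S Y) (v : Y -> A) (t : term S X) :
  eval v (subst u t) = eval (fun x => eval v (u x)) t.
Proof. by elim: t => //= f ts IH; congr op; apply: funext. Qed.

Lemma eval_translate (S T : signature) (s : translation S T) (B : algebra T)
    (X : Type) (v : X -> B) (t : term S X) :
  eval v (translate s t) = eval (v : X -> derived s B) t.
Proof.
elim: t => //= f ts IH; rewrite eval_subst.
by congr (eval _ _); apply: funext.
Qed.

Lemma derived_hom (S T : signature) (s : translation S T) (A B : algebra T)
    (h : A -> B) :
  homomorphism h -> @homomorphism S (derived s A) (derived s B) h.
Proof. by move=> homh f x /=; rewrite eval_hom. Qed.

Lemma models_derived (S T : signature) (s : translation S T) (A B : algebra T) :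
  models A B -> models (derived s A) (derived s B).
Proof.
move=> mAB X p q Apq v; rewrite -!eval_translate.
by apply: mAB => w; rewrite !eval_translate; apply: Apq.
Qed.

(** That two translations are mutually inverse on an algebra is expressed by
    identities. *)
Lemma models_same_operations (S T : signature) (s : translation S T)
    (t : translation T S) (A B : algebra S) :
  models A B ->
  same_operations (@op S (derived s (derived t A))) (@op S A) ->
  same_operations (@op S (derived s (derived t B))) (@op S B).
Proof.
move=> mAB sameA f x.
have := mAB _ (translate t (s f)) (App f Var) _ x.
rewrite eval_translate; apply=> v.
by rewrite eval_translate; apply: sameA.
Qed.

(** * Assertional logics *)

(** The logic asserting the value of a constant term [one] is algebraized by
    the single defining equation [x = one], as soon as equality in the variety
    is expressed by two equations between binary terms and that constant, as it
    is by [x -> y = 1] and [y -> x = 1]. *)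
Lemma logic_of_algebraizable (S : signature) (K : algebra S -> Prop)
    (one : formula S) (epsilon : term S 'I_1) (Dxy Dyx : term S 'I_2) :
  is_variety K ->
  (forall (A : algebra S) (v : nat -> A) (w : 'I_1 -> A),
     eval w epsilon = eval v one) ->
  (forall A : algebra S, K A -> forall x y : A, x = y <->
     eval (tnth [tuple x; y]) Dxy = eval (fun=> x) epsilon /\
     eval (tnth [tuple x; y]) Dyx = eval (fun=> x) epsilon) ->
  equivalent_algebraic_semantics (logic_of one K) K.
Proof.
move=> varK oneE eqE; split=> //.
exists 1, (fun=> Var ord0), (fun=> epsilon), 2, (tnth [tuple Dxy; Dyx]); split.
  move=> Gamma phi; split=> L A KA v Gv.
    move=> i /=; rewrite (oneE A v); apply: L => // g Gg.
    by rewrite -(oneE A v (fun=> eval v g)); apply: (Gv _ Gg ord0).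
  rewrite -(oneE A v (fun=> eval v phi)).
  by apply: (L A KA v _ ord0) => g Gg i /=; rewrite (oneE A v); apply: Gv.
move=> A KA x y; rewrite eqE //.
have oneA w w' : eval w epsilon = eval w' epsilon :> A.
  by rewrite !(oneE A (fun=> x)).
split=> [[xy yx] j i|eq].
  by case: j => [[|[|//]]] lt; rewrite /= /tnth /= ?xy ?yx; apply: oneA.
by have /= -> := eq ord0 ord0; have /= -> := eq ord_max ord0; split; apply: oneA.
Qed.

(** * Terms and the two translations *)

Section DHTerms.
Variable X : Type.
Implicit Types p q : term dh_sig X.

Definition dor p q := @App dh_sig X dh_or (tnth [tuple p; q]).
Definition dand p q := @App dh_sig X dh_and (tnth [tuple p; q]).
Definition dimp p q := @App dh_sig X dh_imp (tnth [tuple p; q]).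
Definition dneg p := @App dh_sig X dh_neg (tnth [tuple p]).
Definition dbot := @App dh_sig X dh_bot (tnth [tuple]).
Definition dtop := @App dh_sig X dh_top (tnth [tuple]).

End DHTerms.

Section LukTerms.
Variable X : Type.
Implicit Types p q : term luk_sig X.

Definition lor p q := @App luk_sig X luk_or (tnth [tuple p; q]).
Definition land p q := @App luk_sig X luk_and (tnth [tuple p; q]).
Definition lneg p := @App luk_sig X luk_neg (tnth [tuple p]).
Definition ld i p := @App luk_sig X (luk_d i) (tnth [tuple p]).
Definition lbot := @App luk_sig X luk_bot (tnth [tuple]).
Definition ltop := @App luk_sig X luk_top (tnth [tuple]).

(** On the three-element chain [lle p q] is 1 if [p <= q], and 0 otherwise. *)
Definition lle p q :=
  land (lor (lneg (ld i1 p)) (ld i1 q)) (lor (lneg (ld i2 p)) (ld i2 q)).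

(** The Heyting implication of the chain. *)
Definition limp p q := lor q (lle p q).

End LukTerms.

Arguments dbot {X}.
Arguments dtop {X}.
Arguments lbot {X}.
Arguments ltop {X}.

(** The Lukasiewicz operations as De Morgan Heyting terms: [d_1 x = x' -> 0]
    and [d_2 x = (x -> 0)'] on the chain. *)
Definition luk_in_dh : translation luk_sig dh_sig := fun f =>
  match f return term dh_sig 'I_(luk_arity f) with
  | luk_or => dor (Var ord0) (Var ord_max)
  | luk_and => dand (Var ord0) (Var ord_max)
  | luk_neg => dneg (Var ord0)
  | luk_d i1 => dimp (dneg (Var ord0)) dbot
  | luk_d i2 => dneg (dimp (Var ord0) dbot)
  | luk_bot => dbot
  | luk_top => dtop
  end.

(** The De Morgan Heyting operations as Lukasiewicz terms. *)
Definition dh_in_luk : translation dh_sig luk_sig := fun f =>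
  match f return term luk_sig 'I_(dh_arity f) with
  | dh_or => lor (Var ord0) (Var ord_max)
  | dh_and => land (Var ord0) (Var ord_max)
  | dh_imp => limp (Var ord0) (Var ord_max)
  | dh_neg => lneg (Var ord0)
  | dh_bot => lbot
  | dh_top => ltop
  end.

(** The three-element Lukasiewicz algebra, taken as a reduct of the De Morgan
    Heyting chain; its operations are the usual ones. *)
Definition luk3 : algebra luk_sig := derived luk_in_dh L1dm.

(** An argument tuple of arity at most 2 is determined by its entries. *)
Lemma tnth1E (T : Type) (x : 'I_1 -> T) : tnth [tuple x ord0] = x.
Proof. by apply: funext => i; rewrite (ord1 i). Qed.

Lemma tnth2E (T : Type) (x : 'I_2 -> T) : tnth [tuple x ord0; x ord_max] = x.
Proof.
by apply: funext => -[[|[|//]] i]; rewrite /tnth /=; congr x; apply: val_inj.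
Qed.

Lemma tnth0E (T : Type) (x : 'I_0 -> T) : tnth [tuple] = x.
Proof. by apply: funext => -[]. Qed.

Lemma dh_in_luk3 :
  same_operations (@op _ (derived dh_in_luk luk3)) (@op _ L1dm).
Proof.
case=> //= x; rewrite -[x]tnth2E.
by move: (x ord0) (x ord_max) => [] [].
Qed.

Lemma luk_in_luk3 :
  same_operations (@op _ (derived luk_in_dh (derived dh_in_luk luk3)))
                  (@op _ luk3).
Proof.
case=> [|||i||] x; [by []|by []|by []| |by []|by []].
rewrite -[x]tnth1E; move: (x ord0) => {x}.
by case: i => -[]; vm_compute.
Qed.

(** * Operations of a Lukasiewicz algebra *)

Section LukOperations.
Variable A : algebra luk_sig.

(** The operations as functions of elements, in the form in which the axioms of
    Lukasiewicz algebras use them. *)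
Definition join (x y : A) : A := @op luk_sig A luk_or (tnth [tuple x; y]).
Definition meet (x y : A) : A := @op luk_sig A luk_and (tnth [tuple x; y]).
Definition neg (x : A) : A := @op luk_sig A luk_neg (tnth [tuple x]).
Definition d (i : Defs.index) (x : A) : A :=
  @op luk_sig A (luk_d i) (tnth [tuple x]).
Definition imp (x y : A) : A :=
  join y (meet (join (neg (d i1 x)) (d i1 y)) (join (neg (d i2 x)) (d i2 y))).
Definition bot : A := @op luk_sig A luk_bot (tnth [tuple]).
Definition top : A := @op luk_sig A luk_top (tnth [tuple]).

Variables (X : Type) (v : X -> A).

Lemma eval_lor p q : eval v (lor p q) = join (eval v p) (eval v q).
Proof. by congr op; rewrite -[LHS]tnth2E. Qed.

Lemma eval_land p q : eval v (land p q) = meet (eval v p) (eval v q).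
Proof. by congr op; rewrite -[LHS]tnth2E. Qed.

Lemma eval_lneg p : eval v (lneg p) = neg (eval v p).
Proof. by congr op; rewrite -[LHS]tnth1E. Qed.

Lemma eval_ld i p : eval v (ld i p) = d i (eval v p).
Proof. by congr op; rewrite -[LHS]tnth1E. Qed.

Lemma eval_lbot : eval v lbot = bot.
Proof. by congr op; rewrite -[LHS]tnth0E. Qed.

Lemma eval_ltop : eval v ltop = top.
Proof. by congr op; rewrite -[LHS]tnth0E. Qed.

Lemma eval_limp p q : eval v (limp p q) = imp (eval v p) (eval v q).
Proof. by rewrite eval_lor eval_land !eval_lor !eval_lneg !eval_ld. Qed.

End LukOperations.

Arguments bot {A}.
Arguments top {A}.

Definition eval_luk :=
  (eval_limp, eval_lor, eval_land, eval_lneg, eval_ld, eval_lbot, eval_ltop).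

(** * Three-valued Lukasiewicz algebras *)

Local Notation V n := (@Var luk_sig nat n).

Lemma luk3_identity (A : algebra luk_sig) (p q : term luk_sig nat) (x y z : A) :
  models luk3 A -> satisfies luk3 p q ->
  eval (nth x [:: x; y; z]) p = eval (nth x [:: x; y; z]) q.
Proof. by move=> mA /mA. Qed.

(** Instantiates the identity [p = q], checked on the 27 valuations of three
    variables in the chain, at the elements [x], [y], [z] of an algebra
    satisfying the identities of the chain. *)
Ltac by_identity mA p q x y z :=
  have := @luk3_identity _ p q x y z mA; rewrite !eval_luk; apply;
  let v := fresh in move=> v; rewrite !eval_luk;
  move: (eval v (V 0)) (eval v (V 1)) (eval v (V 2));
  repeat match goal with i : Defs.index |- _ => destruct i end;
  by move=> [] [] []; vm_compute.

(** The identity [x /\ (x -> y) = y /\ (y -> x)] makes the implication express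
    equality. *)
Lemma models_luk3_imp_eq (A : algebra luk_sig) (x y : A) :
  models luk3 A -> x = y <-> imp x y = top /\ imp y x = top.
Proof.
move=> mA; split=> [->|[xy yx]].
  have imp_refl : imp y y = top.
    by_identity mA (limp (V 0) (V 0)) (@ltop nat) y y y.
  by [].
have meet1 (z : A) : meet z top = z.
  by_identity mA (land (V 0) ltop) (V 0) z z z.
have E : meet x (imp x y) = meet y (imp y x).
  by_identity mA (land (V 0) (limp (V 0) (V 1))) (land (V 1) (limp (V 1) (V 0)))
    x y x.
by rewrite -(meet1 x) -xy E yx meet1.
Qed.

Lemma models_luk3_lukasiewicz (A : algebra luk_sig) :
  models luk3 A -> is_lukasiewicz3_algebra A.
Proof.
move=> mA.
have joinA : associative (@join A).
  move=> x y z.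
  by_identity mA (lor (V 0) (lor (V 1) (V 2)))
    (lor (lor (V 0) (V 1)) (V 2)) x y z.
have meetA : associative (@meet A).
  move=> x y z.
  by_identity mA (land (V 0) (land (V 1) (V 2)))
    (land (land (V 0) (V 1)) (V 2)) x y z.
have joinC : commutative (@join A).
  by move=> x y; by_identity mA (lor (V 0) (V 1)) (lor (V 1) (V 0)) x y x.
have meetC : commutative (@meet A).
  by move=> x y; by_identity mA (land (V 0) (V 1)) (land (V 1) (V 0)) x y x.
have joinK (x y : A) : join x (meet x y) = x.
  by_identity mA (lor (V 0) (land (V 0) (V 1))) (V 0) x y x.
have meetK (x y : A) : meet x (join x y) = x.
  by_identity mA (land (V 0) (lor (V 0) (V 1))) (V 0) x y x.
have meetDl : left_distributive (@meet A) (@join A).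
  move=> x y z.
  by_identity mA (land (lor (V 0) (V 1)) (V 2))
    (lor (land (V 0) (V 2)) (land (V 1) (V 2))) x y z.
have join0 : left_id bot (@join A).
  by move=> x; by_identity mA (lor lbot (V 0)) (V 0) x x x.
have meet1 : left_id top (@meet A).
  by move=> x; by_identity mA (land ltop (V 0)) (V 0) x x x.
have neg0 : neg bot = top :> A.
  by_identity mA (lneg (@lbot nat)) (@ltop nat) (@bot A) (@bot A) (@bot A).
have negU : {morph @neg A : x y / join x y >-> meet x y}.
  move=> x y.
  by_identity mA (lneg (lor (V 0) (V 1))) (land (lneg (V 0)) (lneg (V 1)))
    x y x.
have negK : involutive (@neg A).
  by move=> x; by_identity mA (lneg (lneg (V 0))) (V 0) x x x.
have d_imp (x y : A) : d i1 x = d i1 y -> d i2 x = d i2 y -> imp x y = top.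
  have dC i : join (neg (d i y)) (d i y) = top.
    by_identity mA (lor (lneg (ld i (V 0))) (ld i (V 0))) (@ltop nat) y y y.
  by rewrite /imp => -> ->; rewrite !dC meet1 -(meet1 y) joinC joinK.
split; first by split=> //; split.
split=> [i x y|i x|i j x|i x|].
- by_identity mA (ld i (lor (V 0) (V 1))) (lor (ld i (V 0)) (ld i (V 1))) x y x.
- by_identity mA (lor (ld i (V 0)) (lneg (ld i (V 0)))) (@ltop nat) x x x.
- by_identity mA (ld i (ld j (V 0))) (ld j (V 0)) x x x.
- by_identity mA (ld i (lneg (V 0))) (lneg (ld (flip i) (V 0))) x x x.
- split=> [x|x y d1 d2].
  + by_identity mA (land (ld i1 (V 0)) (ld i2 (V 0))) (ld i1 (V 0)) x x x.
  + by apply/(models_luk3_imp_eq _ _ mA); split; apply: d_imp.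
Qed.

(** The representation theorem: prime filters give enough homomorphisms into the
    three-element algebra. *)
Lemma lukasiewicz3_separated (A : algebra luk_sig) :
  is_lukasiewicz3_algebra A -> separated luk3 A.
Proof.
move=> lukA.
have latA : is_bounded_distributive_lattice (@join A) (@meet A) bot top.
  by case: lukA => -[].
have neg0 : neg bot = top :> A by case: lukA => -[].
have negU : {morph @neg A : x y / join x y >-> meet x y} by case: lukA => -[].
have negK : involutive (@neg A) by case: lukA => -[].
have [_ [dU dC dd dN [d12 dI]]] := lukA.
have {}dU i : {morph @d A i : x y / join x y} by exact: dU.
have {}dC i x : join (d i x) (neg (d i x)) = top :> A by exact: dC.
have {}dd i j x : d i (d j x) = d j x :> A by exact: dd.
have {}dN i x : d i (neg x) = neg (d (flip i) x) :> A by exact: dN.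
have {}d12 x : meet (d i1 x) (d i2 x) = d i1 x :> A by exact: d12.
have {}dI x y : d i1 x = d i1 y -> d i2 x = d i2 y -> x = y :> A.
  exact: dI.
have meetC : commutative (@meet A) by case: latA => _ [].
(* The axioms give d_i 1 = 1 by applying d_i to 1 = d_i 1 \/ (d_i 1)', both
   of whose members are fixed by d_i. *)
have dtop i : d i top = top :> A.
  by rewrite -{1}(dC i top) dU dN !dd dC.
have negI x y : neg (meet x y) = join (neg x) (neg y) :> A.
  by rewrite -[RHS]negK negU !negK.
have neg1 : neg top = bot :> A by rewrite -neg0 negK.
have dbot i : d i bot = bot :> A by rewrite -neg1 dN dtop.
have dIm i : {morph @d A i : x y / meet x y}.
  have flipK : flip (flip i) = i by case: (i).
  by move=> x y; rewrite -[meet x y]negK negI dN dU !dN negU !negK flipK.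
have dF i x : meet (d i x) (neg (d i x)) = bot :> A.
  by rewrite -[meet _ _]negK negI negK -neg1 -(dC i x); case: latA => _ [-> _].
(* The homomorphism determined by a prime filter that contains p but not q. *)
have sep p q : meet p q <> p :> A -> exists2 F : A -> bool, F p && ~~ F q &
    exists2 h : A -> luk3, homomorphism h &
      forall x, F (d i1 x) = (if h x is c1 then true else false) /\
                F (d i2 x) = (if h x is c0 then false else true).
  move=> /(prime_filter_separation latA)[F [Fp Fq FU FI [F0 F1]]].
  exists F; first exact/andP.
  have FN i x : F (neg (d i x)) = ~~ F (d i x).
    have := dC i x => /(congr1 F); have := dF i x => /(congr1 F).
    by rewrite FU FI F0 F1; case: (F _) (F _) => [] [].
  have F12 x : F (d i1 x) ==> F (d i2 x).
    by rewrite -d12 FI; apply/implyP => /andP[].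
  pose h x : luk3 := if F (d i1 x) then c1 else if F (d i2 x) then ca else c0.
  exists h; last by move=> x; rewrite /h; move: (F12 x); do 2 case: (F _).
  case=> [||| j||] x.
  - rewrite -[x]tnth2E; move: (x ord0) (x ord_max) => {x} a b.
    suff: h (join a b) = join3 (h a) (h b) by [].
    rewrite /h !dU !FU; move: (F12 a) (F12 b).
    by do 2 case: (F (d _ a)); do 2 case: (F (d _ b)).
  - rewrite -[x]tnth2E; move: (x ord0) (x ord_max) => {x} a b.
    suff: h (meet a b) = meet3 (h a) (h b) by [].
    rewrite /h !dIm !FI; move: (F12 a) (F12 b).
    by do 2 case: (F (d _ a)); do 2 case: (F (d _ b)).
  - rewrite -[x]tnth1E; move: (x ord0) => {x} a.
    suff: h (neg a) = neg3 (h a) by [].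
    by rewrite /h !dN !FN /=; move: (F12 a); do 2 case: (F _).
  - rewrite -[x]tnth1E; move: (x ord0) => {x} a.
    suff: h (d j a) =
        if j is i1 then imp3 (neg3 (h a)) c0 else neg3 (imp3 (h a) c0).
      by case: (j).
    by rewrite /h !dd; move: (F12 a); case: (j); do 2 case: (F _).
  - rewrite -[x]tnth0E; suff: h bot = c0 by [].
    by rewrite /h !dbot F0.
  - rewrite -[x]tnth0E; suff: h top = c1 by [].
    by rewrite /h !dtop F1.
have le x y i : (forall h : A -> luk3, homomorphism h -> h x = h y) ->
    meet (d i x) (d i y) = d i x.
  move=> eqh; apply: contrapT => /sep[F /andP[Fx /negP Fy] [h homh hE]].
  have [[x1 x2] [y1 y2]] := (hE x, hE y).
  by apply: Fy; case: i Fx; rewrite (x1, x2) (y1, y2) eqh.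
move=> x y eqh.
have deq i : d i x = d i y.
  rewrite -(le x y) // meetC le // => h homh.
  by rewrite eqh.
exact: dI.
Qed.

Lemma lukasiewicz3_models (A : algebra luk_sig) :
  is_lukasiewicz3_algebra A <-> models luk3 A.
Proof.
split; last exact: models_luk3_lukasiewicz.
move=> /lukasiewicz3_separated/separated_variety_generated.
exact: variety_generated_models.
Qed.

(** The last axiom is not an identity, so closure under homomorphic images rests
    on the representation theorem. *)
Lemma lukasiewicz3_variety : is_variety is_lukasiewicz3_algebra.
Proof.
have -> : is_lukasiewicz3_algebra = models luk3.
  by apply: funext => A; apply: propext; apply: lukasiewicz3_models.
exact: models_variety.
Qed.

(** * Term equivalence and algebraizability *)

Lemma term_equivalent_L1dm_lukasiewicz3 :
  term_equivalent (variety_generated L1dm) is_lukasiewicz3_algebra.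
Proof.
exists dh_in_luk, luk_in_dh; split=> [A VA|B lukB|A VA|B lukB].
- apply: models_luk3_lukasiewicz; apply: models_derived.
  exact: variety_generated_models.
- apply: separated_variety_generated => x y eqh.
  apply: (lukasiewicz3_separated lukB) => h homh.
  apply: eqh => f z; rewrite -[RHS]dh_in_luk3.
  exact: (@derived_hom _ _ dh_in_luk B luk3 h homh f z).
- apply: (models_same_operations (variety_generated_models VA)).
  exact: dh_in_luk3.
- apply: models_same_operations luk_in_luk3.
  exact/lukasiewicz3_models.
Qed.

Lemma lukasiewicz3_logic_algebraizable :
  equivalent_algebraic_semantics lukasiewicz3_logic is_lukasiewicz3_algebra.
Proof.
apply: (@logic_of_algebraizable _ _ _ ltop
  (limp (Var ord0) (Var ord_max)) (limp (Var ord_max) (Var ord0))).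
- exact: lukasiewicz3_variety.
- by move=> A v w; rewrite eval_ltop -(eval_ltop v).
move=> A /lukasiewicz3_models mA x y.
by rewrite !eval_limp eval_ltop; apply: models_luk3_imp_eq.
Qed.

Lemma logic_L1dm_algebraizable :
  equivalent_algebraic_semantics logic_L1dm (variety_generated L1dm).
Proof.
have eval_dtop (A : algebra dh_sig) X (v : X -> A) :
    eval v dtop = @top (derived luk_in_dh A).
  by congr op; apply: funext => -[].
apply: (@logic_of_algebraizable _ _ _ dtop
  (dimp (Var ord0) (Var ord_max)) (dimp (Var ord_max) (Var ord0))).
- exact: variety_generated_variety.
- by move=> A v w; rewrite eval_dtop -(eval_dtop _ _ v).
move=> A /variety_generated_models mA x y.
have same := models_same_operations mA dh_in_luk3.
have eval_dimp (v : 'I_2 -> A) p q :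
    eval v (dimp p q) = @imp (derived luk_in_dh A) (eval v p) (eval v q).
  have -> : eval v (dimp p q) =
      @op dh_sig A dh_imp (tnth [tuple eval v p; eval v q]).
    by congr op; rewrite -[LHS]tnth2E.
  rewrite -same.
  exact: (@eval_limp (derived luk_in_dh A) _ _ (Var ord0) (Var ord_max)).
rewrite !eval_dimp eval_dtop.
by apply: (models_luk3_imp_eq (A := derived luk_in_dh A)); apply: models_derived.
Qed.

Theorem theorem7p14 :
  equivalent_logics logic_L1dm lukasiewicz3_logic /\
  term_equivalent (variety_generated L1dm) is_lukasiewicz3_algebra.
Proof.
split; last exact: term_equivalent_L1dm_lukasiewicz3.
exists (variety_generated L1dm), is_lukasiewicz3_algebra; split.
- exact: logic_L1dm_algebraizable.
- exact: lukasiewicz3_logic_algebraizable.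
- exact: term_equivalent_L1dm_lukasiewicz3.
Qed.
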